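(* There exist totally positive elements in $\mathrm{USA}_3$ that are not sums of hermitian squares in $\mathrm{USA}_3$; that is, there is a totally positive $a\in\mathrm{USA}_3$ that cannot be written as a finite sum $a=\sum_i h_ih_i^{\mathsf t}$ with $h_i\in\mathrm{USA}_3$.
   Context: Let $g\in\mathbb{N}$ and $n=3$. Let $\boldsymbol{\xi}=\{\xi_{jpq}:1\le j\le g,\ 1\le p,q\le n\}$ be commuting indeterminates and $\Xi_j=(\xi_{jpq})_{p,q}\in M_n(\mathbb{R}[\boldsymbol\xi])$ the generic $n\times n$ matrices. $\mathrm{GM}_n\subset M_n(\mathbb{R}[\boldsymbol\xi])$ is the $\mathbb{R}$-subalgebra generated by all $\Xi_j$ and their transposes $\Xi_j^{\mathsf t}$; its center is $C_n$. $\mathrm{USA}_n\subset M_n(\mathbb{R}(\boldsymbol\xi))$ is the ring of central quotients of $\mathrm{GM}_n$, i.e. the set of all $c^{-1}h$ with $h\in\mathrm{GM}_n$, $c\in C_n\setminus\{0\}$ (the universal central simple algebra with orthogonal involution of degree $n$), with the transpose involution $\mathsf t$. An element $a\in\mathrm{USA}_n$ is totally positive if $a(X)\succeq0$ (positive semidefinite) for every $X\in M_n(\mathbb{R})^g$ at which $a$ is defined. *)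

(* Defs.v *)
From HB Require Import structures.
From mathcomp Require Import all_boot all_order all_algebra.
From mathcomp Require Import fraction.
From mathcomp Require Import reals.
From mathcomp Require Import mpoly.

Set Implicit Arguments.
Unset Strict Implicit.
Unset Printing Implicit Defensive.

Import Order.TTheory GRing.Theory Num.Theory.
Local Open Scope ring_scope.

Section UniversalAlgebra.
Variables (R : realType) (g n : nat).

(* The indeterminates xi_{jpq} are indexed by triples (j, p, q); [enum_rank]
   and [enum_val] translate between triples and the ordinals used by [mpoly]. *)
Definition gidx : finType := ('I_g * 'I_n * 'I_n)%type.

Definition gpoly := {mpoly R[#|gidx|]}.

Definition gfrac := {fraction gpoly}.

Definition xi (j : 'I_g) (p q : 'I_n) : gpoly := 'X_(enum_rank (j, p, q)).

Definition Xi (j : 'I_g) : 'M[gpoly]_n := \matrix_(p, q) xi j p q.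

Inductive GM : 'M[gpoly]_n -> Prop :=
| GM_scalar (r : R) : GM (r%:MP)%:M
| GM_gen (j : 'I_g) : GM (Xi j)
| GM_gen_tr (j : 'I_g) : GM (Xi j)^T
| GM_add (A B : 'M[gpoly]_n) : GM A -> GM B -> GM (A + B)
| GM_mul (A B : 'M[gpoly]_n) : GM A -> GM B -> GM (A *m B).

Definition GM_center (c : 'M[gpoly]_n) : Prop :=
  GM c /\ forall h : 'M[gpoly]_n, GM h -> c *m h = h *m c.

Definition to_gfrac (A : 'M[gpoly]_n) : 'M[gfrac]_n :=
  map_mx (fun p : gpoly => tofrac p) A.

(* Nonzero central elements are scalar matrices over the polynomial ring, hence
   invertible over the fraction field, so [invmx] is the genuine inverse. *)
Definition USA (a : 'M[gfrac]_n) : Prop :=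
  exists c h : 'M[gpoly]_n,
    [/\ GM_center c, c != 0, GM h & a = invmx (to_gfrac c) *m to_gfrac h].

Definition point (X : 'I_g -> 'M[R]_n) : 'I_#|gidx| -> R :=
  fun i => let: (j, p, q) := enum_val i in X j p q.

(* [f] is defined at [v] iff such a [y] exists, and [y] is then unique: it does
   not depend on the chosen fraction. *)
Definition frac_value (f : gfrac) (v : 'I_#|gidx| -> R) (y : R) : Prop :=
  exists p q : gpoly,
    [/\ q.@[v] != 0, f = tofrac p / tofrac q & y = p.@[v] / q.@[v]].

(* [a] is defined at [X], with [a(X) = B]. *)
Definition mx_value (a : 'M[gfrac]_n) (X : 'I_g -> 'M[R]_n) (B : 'M[R]_n) :
    Prop :=
  forall i j : 'I_n, frac_value (a i j) (point X) (B i j).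

Definition psd (B : 'M[R]_n) : Prop :=
  B^T = B /\ forall v : 'cV[R]_n, 0 <= (v^T *m B *m v) ord0 ord0.

Definition totally_positive (a : 'M[gfrac]_n) : Prop :=
  forall (X : 'I_g -> 'M[R]_n) (B : 'M[R]_n), mx_value a X B -> psd B.

Definition sum_hermitian_squares (a : 'M[gfrac]_n) : Prop :=
  exists (m : nat) (h : 'I_m -> 'M[gfrac]_n),
    (forall i, USA (h i)) /\ a = \sum_(i < m) h i *m (h i)^T.

End UniversalAlgebra.

(* Main.v *)
Require Import Defs.
From mathcomp Require Import all_boot all_order all_algebra.
From mathcomp Require Import fraction reals mpoly.
From mathcomp Require Import fingroup perm ring.

(** Let X be the first generic matrix, A = X - X^T, and let w be the axial
    vector of A, so that A v is the cross product of w and v.  The witness is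
    a = A^3 X^T X A.

    It lies in GM_3, and Cayley-Hamilton for antisymmetric matrices,
    A^3 = - |w|^2 A, turns it into |w|^2 (A X^T) (A X^T)^T ([witnessE]), which
    is positive semidefinite at every real point.

    The obstruction to being a sum of hermitian squares is a grading.  Give
    xi_jpq the degree e_p + e_q in F_2^3.  Then the (p, q) entry of every
    element of GM_3 is homogeneous of degree e_p + e_q ([GM_graded]): this is
    equivariance under conjugation by diagonal sign matrices.  A central
    element is scalar ([center_scalar]), hence of degree 0, so that denominators
    can be cleared and a sum of hermitian squares gives an identity
        C^2 a_11 = sum_i sum_j t_ij^2
    with C homogeneous of degree 0 and t_ij of degree e_1 + e_j (rows and
    columns are numbered 0, 1, 2).  For any monomial order, leading terms of
    squares of real polynomials cannot cancel, so the leading monomial of the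
    right side is m^2 with m of degree e_1 + e_j for some j
    ([lead_square_sum]).  On the left, a suitable order makes the leading
    monomial of a_11 the square of xi_01 xi_12 xi_22, of degree e_0 + e_2
    ([mlead_witness11]).  In dimension 3 this degree is none of the e_1 + e_j:
    a contradiction. *)

Set Implicit Arguments.
Unset Strict Implicit.
Unset Printing Implicit Defensive.

Import Order.TTheory GRing.Theory Num.Theory.
Local Open Scope ring_scope.

(** * Graded polynomials and leading monomials of sums of squares *)

Section Weights.
Variables (V : zmodType) (N : nat) (R : realDomainType).
Implicit Types (w : 'I_N -> V) (m : 'X_{1..N}) (p q : {mpoly R[N]}).

Definition mwt w m : V := \sum_i w i *+ m i.

Lemma mwtD w m1 m2 : mwt w (m1 + m2)%MM = mwt w m1 + mwt w m2.
Proof.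
by rewrite /mwt -big_split; apply: eq_bigr => i _; rewrite mnmDE mulrnDr.
Qed.

Lemma mwt0 w : mwt w 0%MM = 0.
Proof. by rewrite /mwt big1 // => i _; rewrite mnm0E. Qed.

Lemma mwtU w i : mwt w U_(i)%MM = w i.
Proof.
rewrite /mwt (bigD1 i) //= mnm1E eqxx mulr1n big1 ?addr0 // => j ji.
by rewrite mnm1E eq_sym (negbTE ji).
Qed.

Definition graded w v p : Prop := {in msupp p, forall m, mwt w m = v}.

Lemma gradedC w (c : R) : graded w 0 c%:MP.
Proof.
move=> m; rewrite msuppC; case: ifP => // _; rewrite inE => /eqP ->; exact: mwt0.
Qed.

Lemma gradedX w i : graded w (w i) 'X_i.
Proof. by move=> m; rewrite msuppX inE => /eqP ->; exact: mwtU. Qed.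

Lemma gradedD w v p q : graded w v p -> graded w v q -> graded w v (p + q).
Proof.
move=> hp hq m /msuppD_le; rewrite mem_cat => /orP[]; [exact: hp|exact: hq].
Qed.

Lemma gradedM w v1 v2 p q :
  graded w v1 p -> graded w v2 q -> graded w (v1 + v2) (p * q).
Proof.
move=> hp hq m /msuppM_le /allpairsP[[m1 m2] /= [i1 i2 ->]].
by rewrite mwtD hp ?hq.
Qed.

Lemma graded_sum w v (I : finType) (P : pred I) (F : I -> {mpoly R[N]}) :
  (forall i, P i -> graded w v (F i)) -> graded w v (\sum_(i | P i) F i).
Proof.
move=> h; apply: (big_ind (graded w v)) => //; last by move=> *; exact: gradedD.
by move=> m; rewrite msupp0.
Qed.

Lemma graded_prod0 w (I : finType) (P : pred I) (F : I -> {mpoly R[N]}) :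
  (forall i, P i -> graded w 0 (F i)) -> graded w 0 (\prod_(i | P i) F i).
Proof.
move=> h; apply: (big_ind (graded w 0)) => //; first exact: gradedC.
by move=> x y hx hy; rewrite -[0]addr0; exact: gradedM.
Qed.

(** [msym s] renames the variable i to s i; composing with it amounts to
    changing the monomial order, and the weights follow the variables. *)
Lemma graded_msym w v p (s : 'S_N) :
  graded w v p -> graded (fun i => w ((s^-1)%g i)) v (msym s p).
Proof.
move=> hp m; rewrite mcoeff_msupp mcoeff_sym -mcoeff_msupp => /hp <-.
rewrite /mwt (reindex_inj (@perm_inj _ s)) /=; apply: eq_bigr => i _.
by rewrite permK mnmE.
Qed.

Lemma mwt_mlead w v p : graded w v p -> p != 0 -> mwt w (mlead p) = v.
Proof. by move=> hp /mlead_supp /hp. Qed.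

(** Over a real domain this property is stable under sums, because positive
    leading coefficients cannot cancel.  Zero is included so that
    empty sums and squares of zero are covered. *)
Definition lead_square (T : 'X_{1..N} -> Prop) p : Prop :=
  p = 0 \/ 0 < p@_(mlead p) /\ exists2 m, T m & mlead p = (m + m)%MM.

Lemma lead_squareD T p q :
  lead_square T p -> lead_square T q -> lead_square T (p + q).
Proof.
move=> [->|[p0 Tp]]; first by rewrite add0r.
move=> [->|[q0 Tq]]; first by rewrite addr0; right.
wlog le_pq : p q p0 Tp q0 Tq / (mlead p <= mlead q)%O.
  move=> H; case/orP: (le_total (mlead p) (mlead q)) => h; first exact: (H p q).
  by rewrite addrC; exact: (H q p).
have pos : 0 < (p + q)@_(mlead q).
  rewrite mcoeffD; move: le_pq; rewrite le_eqVlt => /predU1P[e|lt].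
    by rewrite addr_gt0 // -e.
  by rewrite (mcoeff_gt_mlead lt) add0r.
have E : mlead (p + q) = mlead q.
  apply/le_anti; have := mleadD_le p q; rewrite (join_r le_pq) => -> /=.
  by apply: msupp_le_mlead; rewrite mcoeff_msupp lt0r_neq0.
by right; rewrite E.
Qed.

Lemma lead_square_sqr T p : (p != 0 -> T (mlead p)) -> lead_square T (p * p).
Proof.
move=> h; have [->|p0] := eqVneq p 0; first by left; rewrite mul0r.
right; rewrite mleadM // mleadcM; split; last by exists (mlead p) => //; exact: h.
by rewrite -expr2 lt0r sqr_ge0 sqrf_eq0 mleadc_eq0 p0.
Qed.

Lemma lead_square_sum T (I : finType) (F : I -> {mpoly R[N]}) :
  (forall i, lead_square T (F i)) -> lead_square T (\sum_i F i).
Proof.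
move=> h; apply: (big_ind (lead_square T)) => //; first by left.
by move=> *; exact: lead_squareD.
Qed.

Lemma mnm_double_inj m1 m2 : (m1 + m1 = m2 + m2)%MM -> m1 = m2.
Proof.
move=> /mnmP h; apply/mnmP => i; have := h i.
by rewrite !mnmDE !addnn => /double_inj.
Qed.

Lemma lt_mnm1 (i j : 'I_N) : (U_(i)%MM < U_(j)%MM)%O = (j < i)%N.
Proof.
have H : forall (i j : 'I_N), (j < i)%N -> (U_(i)%MM < U_(j)%MM)%O.
  move=> {}i {}j lt_ji; apply/ltmcP; first by rewrite !mdeg1.
  exists j => [k kj|]; rewrite !mnm1E.
    by rewrite -!val_eqE /= (gtn_eqF kj) (gtn_eqF (ltn_trans kj lt_ji)).
  by rewrite eqxx -val_eqE /= (gtn_eqF lt_ji).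
case: (ltngtP j i) => h; first exact: H.
  by apply/negbTE; rewrite -leNgt ltW // H.
by rewrite (ord_inj h) ltxx.
Qed.

Lemma mlead_subX (i j : 'I_N) :
  (i < j)%N -> mlead ('X_i - 'X_j : {mpoly R[N]}) = U_(i)%MM.
Proof.
by move=> ij; rewrite mleadDl ?mleadN !mleadXm // lt_mnm1.
Qed.
End Weights.

(** * Antisymmetric matrices of size 3 and their axial vectors *)

Section Antisymmetric.
Variable (P : comNzRingType).
Implicit Types (X c : 'M[P]_3).

Definition asym X := X - X^T.

(** Indices are taken modulo 3; the sign is such that A v is the cross product
    of [axial X] and v. *)
Definition axial X : 'cV[P]_3 := \col_i asym X (i + 2) (i + 1).

Lemma axialE X : (axial X 0 0 = asym X 2 1) * (axial X 1 0 = asym X 0 2) *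
  (axial X 2 0 = asym X 1 0).
Proof. by do !split; rewrite mxE; congr (asym X _ _); apply: val_inj. Qed.

Definition asym_sqnorm X : P :=
  asym X 0 1 ^+ 2 + (asym X 0 2 ^+ 2 + asym X 1 2 ^+ 2).

Lemma trmx_asym X : (asym X)^T = - asym X.
Proof. by rewrite /asym linearB /= trmxK opprB. Qed.

Lemma ord3P (Q : 'I_3 -> Prop) : Q 0 -> Q 1 -> Q 2 -> forall i, Q i.
Proof.
move=> q0 q1 q2 [[|[|[|//]]] h]; [move: q0|move: q1|move: q2];
  by congr Q; apply: val_inj.
Qed.

Lemma sum3 (V : nmodType) (F : 'I_3 -> V) : \sum_i F i = F 0 + (F 1 + F 2).
Proof.
rewrite !big_ord_recl big_ord0 addr0; congr (_ + (F _ + F _)); exact: val_inj.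
Qed.

(** Cayley-Hamilton: A has trace 0 and determinant 0, and the sum of its
    principal 2 by 2 minors is the squared norm of the axial vector. *)
Lemma asym_cube X : asym X *m asym X *m asym X = - (asym_sqnorm X *: asym X).
Proof.
apply/matrixP; elim/ord3P; elim/ord3P; rewrite /asym_sqnorm /asym;
  rewrite !mxE !sum3 !mxE !sum3 !mxE; ring.
Qed.

Lemma asym_axial X : asym X *m axial X = 0.
Proof.
apply/matrixP=> i j; rewrite ord1 mxE sum3 !axialE.
by elim/ord3P: i; rewrite !mxE; ring.
Qed.

(** A vector killed by A has zero cross product with the axial vector, so the
    two are parallel; both sides are cleared of denominators. *)
Lemma asym_ker X (v : 'cV[P]_3) : asym X *m v = 0 ->
  axial X 0 0 *: v = v 0 0 *: axial X.
Proof.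
move=> /matrixP h.
have h1 := h 1 0; have h2 := h 2 0; rewrite !mxE !sum3 !mxE in h1 h2.
suff H i : axial X 0 0 * v i 0 = v 0 0 * axial X i 0.
  have scaleE a (u : 'cV[P]_3) k : (a *: u) k 0 = a * u k 0 by rewrite mxE.
  by apply/matrixP => i j; rewrite ord1 !scaleE; exact: H.
elim/ord3P: i; rewrite !axialE !mxE.
- by rewrite mulrC.
- by apply: subr0_eq; rewrite -[RHS]h2; ring.
- by apply: subr0_eq; rewrite -[RHS]oppr0 -h1; ring.
Qed.

End Antisymmetric.

Definition krylov (P : comNzRingType) (X : 'M[P]_3) : 'M[P]_3 :=
  \matrix_(i, j) (X ^+ j *m axial X) i 0.

Section Map.
Variables (P P' : comNzRingType) (f : {rmorphism P -> P'}).

Lemma map_asym X : map_mx f (asym X) = asym (map_mx f X).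
Proof. by rewrite /asym map_mxB -map_trmx. Qed.

Lemma map_axial X : map_mx f (axial X) = axial (map_mx f X).
Proof.
apply/matrixP => i j.
by rewrite [LHS]mxE [axial X i j]mxE [RHS]mxE -map_asym [RHS]mxE.
Qed.

Lemma map_krylov X : map_mx f (krylov X) = krylov (map_mx f X).
Proof.
apply/matrixP => i j; rewrite [LHS]mxE [krylov X i j]mxE [RHS]mxE.
by rewrite -map_axial -(rmorphXn (map_mx f)) -map_mxM [RHS]mxE.
Qed.
End Map.

(** A matrix c commuting with A preserves the kernel of A, so c w = lambda w
    with lambda in the fraction field.  Since c also commutes with X, it acts
    as lambda on X w and X^2 w, and these vectors form a basis.  The proof
    clears the denominator w_0 of lambda = mu / w_0. *)
Lemma commuting_scalar (P : idomainType) (X c : 'M[P]_3) :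
  axial X 0 0 != 0 -> \det (krylov X) != 0 ->
  c *m X = X *m c -> c *m asym X = asym X *m c -> c = (c 0 0)%:M.
Proof.
move=> w0 dK cX cA; set w := axial X in w0 *.
have /asym_ker cw : asym X *m (c *m w) = 0.
  by rewrite mulmxA -cA -mulmxA asym_axial mulmx0.
set mu := (c *m w) 0 0 in cw.
pose M := w 0 0 *: c - mu%:M.
have Mw : M *m w = 0.
  by rewrite mulmxBl -scalemxAl cw mul_scalar_mx subrr.
have MX : M *m X = X *m M.
  by rewrite mulmxBl mulmxBr -scalemxAl -scalemxAr cX scalar_mxC.
have MK : M *m krylov X = 0.
  apply/matrixP => i j.
  have -> : (M *m krylov X) i j = (M *m (X ^+ j *m w)) i 0.
    by rewrite !mxE; apply: eq_bigr => k _; rewrite [krylov _ _ _]mxE.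
  have -> : M *m (X ^+ j *m w) = 0; last by rewrite !mxE.
  elim: (val j) => [|k IH]; first by rewrite expr0 mul1mx.
  rewrite exprS -[X * _]/(X *m _) -(mulmxA X) (mulmxA M) MX.
  by rewrite -(mulmxA X) IH mulmx0.
have M0 : M = 0.
  have : \det (krylov X) *: M = 0.
    by rewrite -mul_mx_scalar -mul_mx_adj mulmxA MK mul0mx.
  move=> /matrixP h; apply/matrixP => i j; have := h i j.
  by rewrite !mxE => /eqP; rewrite mulf_eq0 (negbTE dK) => /eqP.
have key i j : w 0 0 * c i j = mu *+ (i == j).
  by move/matrixP/(_ i j): M0; rewrite !mxE => /eqP; rewrite subr_eq0 => /eqP.
apply/matrixP => i j; apply: (mulfI w0).
have -> : (c 0 0)%:M i j = c 0 0 *+ (i == j) by rewrite mxE.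
by rewrite mulrnAr !key eqxx.
Qed.

(** * The grading of the algebra of generic matrices *)

Section Graded.
Variables (R : realType) (g n : nat) (V : zmodType) (d : 'I_n -> V).
Hypothesis d2 : forall p, d p + d p = 0.

Definition xi_weight (i : 'I_#|gidx g n|) : V :=
  let: (_, p, q) := enum_val i in d p + d q.

Lemma graded_xi j p q : graded xi_weight (d p + d q) (xi R j p q : {mpoly R[_]}).
Proof.
have -> : d p + d q = xi_weight (enum_rank (j, p, q)).
  by rewrite /xi_weight enum_rankK.
exact: gradedX.
Qed.

(** Products respect the degrees because d k cancels against itself in
    (d p + d k) + (d k + d q). *)
Lemma GM_graded (h : 'M[gpoly R g n]_n) : GM h ->
  forall p q, graded xi_weight (d p + d q) (h p q : {mpoly R[_]}).
Proof.
elim=> {h} [r|j|j|A B _ hA _ hB|A B _ hA _ hB] p q.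
- rewrite mxE; case: eqP => [->|_]; first by rewrite d2 mulr1n; exact: gradedC.
  by rewrite mulr0n => m; rewrite msupp0.
- by rewrite mxE; exact: graded_xi.
- by rewrite !mxE addrC; exact: graded_xi.
- by rewrite mxE; exact: gradedD.
- rewrite mxE; apply: graded_sum => k _.
  have -> : d p + d q = (d p + d k) + (d k + d q).
    by rewrite addrACA -addrA (addrA (d k)) d2 add0r.
  exact: gradedM.
Qed.

Lemma GM_opp (h : 'M[gpoly R g n]_n) : GM h -> GM (- h).
Proof.
move=> hh; have -> : - h = ((-1)%:MP : gpoly R g n)%:M *m h.
  by rewrite mul_scalar_mx mpolyCN mpolyC1 scaleN1r.
by apply: GM_mul => //; exact: GM_scalar.
Qed.
End Graded.

(** * Evaluation at real points and the centre *)

Section Points.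
Variables (R : realType) (g : nat).
Local Notation n := 3.
Implicit Types (X : 'I_g -> 'M[R]_n).

Definition mx_at X (h : 'M[gpoly R g n]_n) : 'M[R]_n :=
  map_mx (meval (point X)) h.

Lemma Xi_at X j : mx_at X (Xi R n j) = X j.
Proof.
by apply/matrixP=> p q; rewrite !mxE /xi mevalXU /point enum_rankK.
Qed.

(** If a polynomial h equals p / q, then h q = p already holds for
    polynomials and can be evaluated. *)
Lemma mx_value_poly X (h : 'M[gpoly R g n]_n) B :
  mx_value (to_gfrac h) X B -> B = mx_at X h.
Proof.
move=> v; apply/matrixP => i j; have [p [q [q0 + ->]]] := v i j.
rewrite !mxE => e; have qn0 : tofrac q != 0.
  by rewrite tofrac_eq0; apply: contraNneq q0 => ->; rewrite meval0.
have : tofrac (h i j * q) = tofrac p by rewrite tofracM e divfK.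
by move=> /eqP; rewrite tofrac_eq => /eqP <-; rewrite mevalM mulfK.
Qed.

(** A point at which w, X w, X^2 w are independent: w = e_0 + e_2, X w = e_1
    and X^2 w = e_2. *)
Definition shift : 'M[R]_3 := \matrix_(i, j) ((i == j.+1 :> nat)%:R).

Lemma axial_shift : axial shift = \col_i (i != 1)%:R.
Proof.
by apply/matrixP => i j; rewrite ord1; elim/ord3P: i; rewrite axialE !mxE /=; ring.
Qed.

Lemma det_krylov_shift : \det (krylov shift) = 1.
Proof.
have e0 i : krylov shift i 0 = (i != 1)%:R.
  by rewrite mxE expr0 mul1mx axial_shift mxE.
have e1 i : krylov shift i 1 = (i == 1)%:R.
  rewrite mxE expr1 axial_shift; elim/ord3P: i; rewrite !mxE sum3 !mxE /=; ring.
have e2 i : krylov shift i 2 = (i == 2)%:R.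
  rewrite mxE exprS expr1 -[shift * _]/(shift *m shift) axial_shift.
  elim/ord3P: i; rewrite !mxE sum3 !mxE !sum3 !mxE /=; ring.
rewrite det_trig.
  by apply: big1 => i _; elim/ord3P: i; rewrite ?e0 ?e1 ?e2.
apply/is_trig_mxP => i j; elim/ord3P: j; elim/ord3P: i => //;
  by rewrite ?e0 ?e1 ?e2.
Qed.

(** The nonvanishing conditions of [commuting_scalar] are polynomial in the
    entries of X, so for the generic matrix one real point suffices. *)
Lemma center_scalar (c : 'M[gpoly R g n]_n) : (0 < g)%N ->
  GM_center c -> c = (c 0 0)%:M.
Proof.
move=> hg [_ cc]; pose j0 := Ordinal hg.
have cX := cc _ (GM_gen R n j0); have cXT := cc _ (GM_gen_tr R n j0).
pose f : {rmorphism gpoly R g n -> R} := meval (point (fun=> shift)).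
have eval_X : map_mx f (Xi R n j0) = shift by rewrite -/(mx_at _ _) Xi_at.
apply: (commuting_scalar (X := Xi R n j0)) => //.
- have /matrixP /(_ 0 0) e := map_axial f (Xi R n j0).
  have : f (axial (Xi R n j0) 0 0) != 0.
    rewrite mxE eval_X axial_shift mxE /= in e.
    by rewrite [X in X != 0]e oner_neq0.
  by apply: contraNneq => ->; rewrite rmorph0.
- have : f (\det (krylov (Xi R n j0))) != 0.
    by rewrite -det_map_mx map_krylov eval_X det_krylov_shift oner_neq0.
  by apply: contraNneq => ->; rewrite rmorph0.
- by rewrite /asym mulmxBl mulmxBr cX cXT.
Qed.
End Points.

(** * The witness and its total positivity *)

Section Element.
Variable (P : comNzRingType).
Implicit Types (X : 'M[P]_3).

Definition witness X := asym X *m asym X *m asym X *m X^T *m X *m asym X.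

(** This form shows positivity: |w|^2 times a hermitian square.  The factor
    A^3 = - |w|^2 A absorbs the scalar |w|^2, and so the product stays a word in
    A, X and X^T. *)
Lemma witnessE X :
  witness X = asym_sqnorm X *: ((asym X *m X^T) *m (asym X *m X^T)^T).
Proof.
rewrite /witness asym_cube trmx_mul trmxK trmx_asym mulmxN mulmxN.
by rewrite -scaleNr -!scalemxAl scaleNr -scalerN !mulmxA.
Qed.
End Element.

Lemma map_witness (P P' : comNzRingType) (f : {rmorphism P -> P'}) (X : 'M[P]_3) :
  map_mx f (witness X) = witness (map_mx f X).
Proof. by rewrite /witness !map_mxM map_asym map_trmx. Qed.

Lemma psd_gram (R : realType) (n : nat) (a : R) (M : 'M[R]_n) :
  0 <= a -> psd (a *: (M *m M^T)).
Proof.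
move=> a0; split; first by rewrite linearZ /= trmx_mul trmxK.
move=> v; rewrite -scalemxAr -scalemxAl mxE mulr_ge0 //.
have -> : v^T *m (M *m M^T) *m v = (v^T *m M) *m (v^T *m M)^T.
  by rewrite trmx_mul trmxK !mulmxA.
by rewrite mxE sumr_ge0 // => k _; rewrite [_^T _ _]mxE -expr2 sqr_ge0.
Qed.

Lemma asym_sqnorm_ge0 (R : realDomainType) (X : 'M[R]_3) : 0 <= asym_sqnorm X.
Proof. by rewrite /asym_sqnorm !addr_ge0 ?sqr_ge0. Qed.

Lemma GM_asym (R : realType) (g : nat) (j : 'I_g) : GM (asym (Xi R 3 j)).
Proof. by apply: GM_add; [exact: GM_gen | apply: GM_opp; exact: GM_gen_tr]. Qed.

Lemma GM_witness (R : realType) (g : nat) (j : 'I_g) : GM (witness (Xi R 3 j)).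
Proof.
have hA := GM_asym R j; have hX := GM_gen R 3 j; have hXT := GM_gen_tr R 3 j.
by rewrite /witness; repeat apply: GM_mul.
Qed.

Lemma witness_positive (R : realType) (g : nat) (j : 'I_g) :
  totally_positive (to_gfrac (witness (Xi R 3 j))).
Proof.
move=> X B /mx_value_poly ->.
rewrite /mx_at map_witness -/(mx_at X _) Xi_at witnessE.
exact/psd_gram/asym_sqnorm_ge0.
Qed.

Lemma USA_poly (R : realType) (g n : nat) (h : 'M[gpoly R g n.+1]_n.+1) :
  GM h -> USA (to_gfrac h).
Proof.
move=> hh; exists 1, h; split=> //.
- split; first by rewrite -[1]/(1%:M) -mpolyC1; exact: GM_scalar.
  by move=> k _; rewrite mul1mx mulmx1.
- exact: oner_neq0.
- by rewrite /to_gfrac map_mx1 invmx1 mul1mx.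
Qed.

(** * Clearing denominators *)

(** Central denominators are scalar, so they can be multiplied together; the
    numerators and denominators stay in GM, which keeps their degrees
    known. *)
Lemma common_denominator (R : realType) (g : nat) (hg : (0 < g)%N)
    (a : 'M[gpoly R g 3]_3) :
  sum_hermitian_squares (to_gfrac a) ->
  exists (m : nat) (c : 'I_m -> gpoly R g 3) (k : 'I_m -> 'M[gpoly R g 3]_3),
   [/\ forall i, c i != 0, forall i, GM (c i)%:M, forall i, GM (k i) &
    (\prod_i c i) ^+ 2 *: a =
      \sum_i (\prod_(l | l != i) c l) ^+ 2 *: (k i *m (k i)^T)].
Proof.
move=> [m [h [hU ea]]].
have H i : exists ck : gpoly R g 3 * 'M[gpoly R g 3]_3,
    [/\ ck.1 != 0, GM ck.1%:M, GM ck.2 &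
      h i = (tofrac ck.1)^-1 *: to_gfrac ck.2].
  have [c [k [cc c0 kG ->]]] := hU i.
  have cE := center_scalar hg cc; exists (c 0 0, k); split=> //=.
  - apply: contra_neq c0 => e.
    by rewrite cE e; apply/matrixP=> ? ?; rewrite !mxE mul0rn.
  - by rewrite -cE; case: cc.
  - by rewrite [in LHS]cE /to_gfrac map_scalar_mx invmx_scalar mul_scalar_mx.
have {H}[ck hck] := fin_all_exists H.
exists m, (fun i => (ck i).1), (fun i => (ck i).2); split=> [i|i|i|];
  try by case: (hck i).
pose C := \prod_i (ck i).1; rewrite -/C.
have C0 i : tofrac (ck i).1 != 0 by rewrite tofrac_eq0; case: (hck i).
have CE i :
    tofrac C * (tofrac (ck i).1)^-1 = tofrac (\prod_(l | l != i) (ck l).1).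
  by rewrite /C (bigD1 i) //= tofracM mulrAC divff // mul1r.
have inj : injective (@to_gfrac R g 3).
  move=> A B /matrixP e; apply/matrixP => i j; have := e i j.
  by rewrite !mxE => /eqP; rewrite tofrac_eq => /eqP.
apply: inj; rewrite /to_gfrac map_mxZ -/(to_gfrac a) ea scaler_sumr raddf_sum.
apply: eq_bigr => i _; have [_ _ _ ->] := hck i.
rewrite linearZ /= -scalemxAl -scalemxAr !scalerA map_mxZ map_mxM -map_trmx.
by rewrite !rmorphXn /= -CE exprMn [in RHS]expr2 -!mulrA.
Qed.

(** * The leading monomial of a diagonal entry of the witness *)

Lemma perm_triple (T : finType) (a b c x y z : T) :
  uniq [:: a; b; c] -> uniq [:: x; y; z] ->
  exists s : {perm T}, [/\ s a = x, s b = y & s c = z].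
Proof.
rewrite /= !inE !negb_or => /and3P[/andP[ab ac] bc _] /and3P[/andP[xy xz] yz _].
pose s1 := tperm a x; pose s2 := (s1 * tperm (s1 b) y)%g.
have s1a : s1 a = x by rewrite tpermL.
have s2a : s2 a = x.
  by rewrite permM s1a tpermD // -1?s1a ?(inj_eq perm_inj) 1?eq_sym // s1a.
have s2b : s2 b = y by rewrite permM tpermL.
exists (s2 * tperm (s2 c) z)%g; split; last by rewrite permM tpermL.
- by rewrite permM s2a tpermD // 1?eq_sym // -s2a (inj_eq perm_inj).
- by rewrite permM s2b tpermD // 1?eq_sym // -s2b (inj_eq perm_inj).
Qed.

(** The variable of X in position (p, q) is the one of index u p q.  The
    hypotheses say that X_22 > X_01 > X_12 > all other entries in the monomial
    order.  The reason for this order: |w|^2 must lead with X_01^2, and the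
    sum of the squares of row 1 of A X^T with its column 2, so that half of
    the product has degree (e_0 + e_1) + (e_1 + e_2) = e_0 + e_2. *)
Section Lead.
Variables (N : nat) (R : realDomainType) (u : 'I_3 -> 'I_3 -> 'I_N).
Hypotheses (u_inj : forall p q p' q', u p q = u p' q' -> (p, q) = (p', q')).
Hypotheses (u22 : u 2 2 = 0%N :> nat) (u01 : u 0 1 = 1%N :> nat)
  (u12 : u 1 2 = 2%N :> nat).
Let X : 'M[{mpoly R[N]}]_3 := \matrix_(p, q) 'X_(u p q).
Local Notation U p q := (U_(u p%R q%R))%MM.

Let big p q : (p, q) \notin [:: (2, 2); (0, 1); (1, 2)] -> (2 < u p q)%N.
Proof.
rewrite !inE !negb_or => /and3P[n1 n2 n3].
have ne p' q' : (p, q) != (p', q') -> (u p q != u p' q' :> nat).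
  by apply: contra => /eqP /ord_inj /u_inj ->.
move: (ne _ _ n1) (ne _ _ n2) (ne _ _ n3); rewrite u22 u01 u12.
by case: (u p q : nat) => [|[|[|]]].
Qed.

Let mlead_sq_lt (p q : {mpoly R[N]}) :
  (mlead p < mlead q)%O -> (mlead (p ^+ 2) < mlead (q ^+ 2))%O.
Proof.
move=> lt; have q0 : q != 0 by apply: contraTneq lt => ->; rewrite mlead0 ltx0.
by rewrite !expr2 (mleadM q0 q0) (le_lt_trans (mleadM_le _ _)) // ltm_add.
Qed.

Lemma mlead_neq0 (p : {mpoly R[N]}) i : mlead p = U_(i)%MM -> p != 0.
Proof.
by move=> e; apply: contra_eq_neq e => ->; rewrite mlead0 eq_sym -mdeg_eq0 mdeg1.
Qed.

Lemma asymE p q : asym X p q = 'X_(u p q) - 'X_(u q p).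
Proof. by rewrite !mxE. Qed.

Lemma lead01 : mlead (asym X 0 1) = U 0 1.
Proof. by rewrite asymE mlead_subX // u01 ltnW // big. Qed.

Lemma lead10 : mlead (asym X 1 0) = U 0 1.
Proof. by rewrite -mleadN -lead01 !asymE opprB. Qed.

Lemma lead12 : mlead (asym X 1 2) = U 1 2.
Proof. by rewrite asymE mlead_subX // u12 big. Qed.

Lemma lead02 : (mlead (asym X 0 2) < U 1 2)%O.
Proof.
rewrite asymE (le_lt_trans (mleadB_le _ _)) // !mleadXm ltUx.
by rewrite !lt_mnm1 u12 !big.
Qed.

Lemma mlead_sqnorm : mlead (asym_sqnorm X) = (U 0 1 + U 0 1)%MM.
Proof.
have n01 := mlead_neq0 lead01.
rewrite /asym_sqnorm mleadDl; first by rewrite expr2 mleadM // lead01.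
have l1 : (mlead (asym X 1 2) < mlead (asym X 0 1))%O.
  by rewrite lead01 lead12 lt_mnm1 u12 u01.
rewrite (le_lt_trans (mleadD_le _ _)) // ltUx !mlead_sq_lt //.
by rewrite (lt_trans lead02) // -lead12.
Qed.

Let f j := (asym X *m X^T) 1 j.

Let fE j : f j = asym X 1 0 * 'X_(u j 0) + asym X 1 2 * 'X_(u j 2).
Proof.
rewrite /f mxE sum3 [asym X 1 1]asymE subrr mul0r add0r.
by rewrite ![X^T _ _]mxE ![X _ _]mxE.
Qed.

Let f_le j : (mlead (f j) <= (U 0 1 + U j 0)%MM `|` (U 1 2 + U j 2)%MM)%O.
Proof.
rewrite fE (le_trans (mleadD_le _ _)) // leU2 //.
  by rewrite (le_trans (mleadM_le _ _)) // lead10 mleadXm.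
by rewrite (le_trans (mleadM_le _ _)) // lead12 mleadXm.
Qed.

Lemma mlead_f2 : mlead (f 2) = (U 1 2 + U 2 2)%MM.
Proof.
have X0 i : ('X_i : {mpoly R[N]}) != 0.
  by apply: (@mlead_neq0 _ i); rewrite mleadXm.
rewrite fE addrC mleadDl !mleadM ?(mlead_neq0 lead10) ?(mlead_neq0 lead12) //;
  rewrite ?lead10 ?lead12 !mleadXm //.
by rewrite [X in (_ < X)%O]addmC ltm_add // lt_mnm1 ?u22 ?u01 ?u12 // big.
Qed.

Lemma mlead_f (j : 'I_3) : j != 2 -> (mlead (f j) < mlead (f 2))%O.
Proof.
move=> j2; rewrite (le_lt_trans (f_le j)) // mlead_f2 ltUx; apply/andP; split.
  rewrite [X in (_ < X)%O]addmC ltm_add // lt_mnm1 ?u22 ?u01 ?u12 // big //.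
  by rewrite !inE !xpair_eqE !andbF.
rewrite ltmc_add2r lt_mnm1 u22.
have [->|j1] := eqVneq j 1; first by rewrite u12.
rewrite (ltn_trans _ (big _)) // !inE !xpair_eqE eqxx.
by rewrite !andbT !negb_or j2 j1 andbF.
Qed.

Lemma mlead_witness11 :
  mlead (witness X 1 1) =
    ((U 0 1 + (U 1 2 + U 2 2)) + (U 0 1 + (U 1 2 + U 2 2)))%MM.
Proof.
have n0 : asym_sqnorm X != 0.
  apply/eqP => e; have := mlead_sqnorm; rewrite e mlead0 => /(congr1 mdeg).
  by rewrite mdegD mdeg0 !mdeg1.
have f2 : f 2 != 0.
  apply/eqP => e; have := mlead_f2; rewrite e mlead0 => /(congr1 mdeg).
  by rewrite mdegD mdeg0 !mdeg1.
have -> : witness X 1 1 = asym_sqnorm X * (f 2 ^+ 2 + (f 0 ^+ 2 + f 1 ^+ 2)).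
  rewrite witnessE mxE; congr (_ * _); rewrite mxE sum3 ![_^T _ 1]mxE -!expr2.
  by rewrite addrA addrC.
have lt : (mlead (f 0 ^+ 2 + f 1 ^+ 2) < mlead (f 2 ^+ 2))%O.
  by rewrite (le_lt_trans (mleadD_le _ _)) // ltUx !mlead_sq_lt ?mlead_f.
have lS := mleadDl lt.
have S0 : f 2 ^+ 2 + (f 0 ^+ 2 + f 1 ^+ 2) != 0.
  by apply: contraTneq lt => e; move: lS; rewrite e mlead0 => <-; rewrite ltx0.
rewrite mleadM // lS mlead_sqnorm expr2 mleadM // mlead_f2.
by apply/mnmP => i; rewrite !mnmDE addnACA.
Qed.
End Lead.

(** * The witness is not a sum of hermitian squares *)

Lemma msym_var (N : nat) (R : nzRingType) (s : 'S_N) (i : 'I_N) :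
  msym s ('X_i : {mpoly R[N]}) = 'X_(s i).
Proof.
rewrite msymX; congr 'X_[_]; apply/mnmP => k.
by rewrite mnmE !mnm1E -(inj_eq (@perm_inj _ s)) permKV.
Qed.

Lemma witness_not_sum_hermitian_squares (R : realType) (g : nat) (j0 : 'I_g) :
  ~ sum_hermitian_squares (to_gfrac (witness (Xi R 3 j0))).
Proof.
have hg : (0 < g)%N by apply: leq_ltn_trans (ltn_ord j0).
move=> /(common_denominator hg)[m [c [k [c0 cG kG /matrixP/(_ 1 1)]]]].
rewrite mxE summxE.
set a11 := witness _ 1 1; set C := \prod_i c i.
pose t i j := (\prod_(l | l != i) c l) * k i 1 j.
have -> : \sum_i (((\prod_(l | l != i) c l) ^+ 2 *: (k i *m (k i)^T)) 1 1)
    = \sum_i \sum_j t i j * t i j.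
  apply: eq_bigr => i _; rewrite mxE mxE mulr_sumr; apply: eq_bigr => j _.
  by rewrite [_^T _ _]mxE /t; ring.
move=> eC.
pose r p q := enum_rank (j0, p, q) : 'I_#|gidx g 3|.
have r_inj p q p' q' : r p q = r p' q' -> (p, q) = (p', q').
  by move=> /enum_rank_inj[-> ->].
have N2 : (2 < #|gidx g 3|)%N.
  by rewrite !card_prod !card_ord -mulnA (leq_trans _ (leq_pmull _ hg)).
(* An order of the variables as required by [mlead_witness11]. *)
have [s [s22 s01 s12]] : exists s : 'S_#|gidx g 3|,
    [/\ s (r 2 2) = Ordinal (ltnW (ltnW N2)), s (r 0 1) = Ordinal (ltnW N2) &
        s (r 1 2) = Ordinal N2].
  apply: perm_triple => //.
  by rewrite /= !inE /r !(inj_eq enum_rank_inj) !xpair_eqE eqxx.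
pose d (p : 'I_3) : 'rV['F_2]_3 := delta_mx 0 p.
have d2 p : d p + d p = 0.
  by apply/rowP => i; rewrite !mxE; case: (_ && _); apply: val_inj.
pose w i := xi_weight d ((s^-1)%g i).
have wr p q : w (s (r p q)) = d p + d q.
  by rewrite /w permK /xi_weight /r enum_rankK.
have cW i : graded w 0 (msym s (c i)).
  apply: graded_msym; rewrite -(d2 0).
  have -> : c i = (c i)%:M (0 : 'I_3) 0 by rewrite mxE eqxx mulr1n.
  exact: GM_graded.
pose u p q := s (r p q).
have u_inj p q p' q' : u p q = u p' q' -> (p, q) = (p', q').
  by move=> /perm_inj/r_inj.
have msym_a : msym s a11 = witness (\matrix_(p, q) 'X_(u p q)) 1 1.
  have -> : msym s a11 = map_mx (msym s) (witness (Xi R 3 j0)) 1 1 by rewrite mxE.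
  rewrite map_witness; congr (witness _ 1 1); apply/matrixP => p q.
  by rewrite !mxE [LHS]msym_var.
have u22 : u 2 2 = 0%N :> nat by rewrite /u s22.
have u01 : u 0 1 = 1%N :> nat by rewrite /u s01.
have u12 : u 1 2 = 2%N :> nat by rewrite /u s12.
have := mlead_witness11 R u_inj u22 u01 u12; rewrite -msym_a => lead_a.
have a0 : msym s a11 != 0.
  apply/eqP => e; move: lead_a; rewrite e mlead0 => /(congr1 mdeg).
  by rewrite !mdegD mdeg0 !mdeg1.
have C0 : msym s C != 0.
  by rewrite (raddf_eq0 _ (@inj_msym _ _ s)); apply/prodf_neq0 => i _; exact: c0.
have CW : graded w 0 (msym s C).
  by rewrite rmorph_prod; apply: graded_prod0 => i _; exact: cW.
pose T m := exists j, mwt w m = d 1 + d j.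
(* Half of the leading exponent has degree e_1 + e_j, read off the squares... *)
have : lead_square T (msym s (C ^+ 2 * a11)).
  rewrite eC rmorph_sum; apply: lead_square_sum => i.
  rewrite rmorph_sum; apply: lead_square_sum => j.
  rewrite rmorphM; apply: lead_square_sqr => t0; exists j.
  apply: mwt_mlead t0; rewrite /t rmorphM -[d 1 + d j]add0r.
  apply: gradedM; last by apply: graded_msym; exact: GM_graded.
  by rewrite rmorph_prod; apply: graded_prod0 => l _; exact: cW.
rewrite rmorphM expr2 rmorphM => -[/eqP|[_ [n [j nj]]]].
  by rewrite !mulf_eq0 (negbTE C0) (negbTE a0).
(* ... and degree e_0 + e_2, read off the witness. *)
rewrite !mleadM ?mulf_neq0 // lead_a.
set mC := mlead (msym s C) => e.
have {e} : n = (mC + (U_(u 0%R 1%R) + (U_(u 1%R 2%R) + U_(u 2%R 2%R))))%MM.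
  by apply: mnm_double_inj; rewrite -e; apply/mnmP => i; rewrite !mnmDE addnACA.
move=> e; move: nj; rewrite e !mwtD !mwtU !wr (mwt_mlead CW C0) add0r d2 addr0.
rewrite -addrA (addrA (d 1)) d2 add0r => /rowP h.
(* Coordinate 1 forces j = 1, and then coordinate 0 reads 1 = 0. *)
have := h 1; have := h 0; rewrite !mxE /=.
by elim/ord3P: j {h}.
Qed.

Theorem theorem1 (R : realType) (g : nat) (hg : (0 < g)%N) :
  exists a : 'M[gfrac R g 3]_3,
    USA a /\ totally_positive a /\ ~ sum_hermitian_squares a.
Proof.
pose X := Xi R 3 (Ordinal hg); exists (to_gfrac (witness X)); split; last split.
- exact/USA_poly/GM_witness.
- exact: witness_positive.
- exact: witness_not_sum_hermitian_squares.
Qed.
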